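(* Let $H\in(\tfrac12,1)$, let $(L_t)_{t\in\mathbb R}$ be a two-sided Lévy process without Gaussian component with $\mathbb E L_1=0$, $\mathbb E L_1^2<\infty$, and let $X_t=\int_{-\infty}^t f_H(t,s)\,dL_s$ be the fLpMvN. Then for all $-\infty<s<t<\infty$, $$\sum_{j=1}^{2^n}\big(X_{s+\frac{j}{2^n}(t-s)}-X_{s+\frac{j-1}{2^n}(t-s)}\big)^2\to0\quad\text{a.s. as }n\to\infty.$$
   Context: A two-sided Lévy process is $L_t=L^{(1)}_t$ for $t\ge0$ and $L_t=-L^{(2)}_{-(t-)}$ for $t<0$, with $L^{(1)},L^{(2)}$ i.i.d. Lévy processes. Mandelbrot–Van Ness kernel: $f_H(t,s)=C_H\big((t-s)_+^{H-1/2}-(-s)_+^{H-1/2}\big)$ with $C_H=\big(\int_0^\infty((1+s)^{H-1/2}-s^{H-1/2})^2ds+\tfrac1{2H}\big)^{-1/2}$. The integral is the $L^2(\mathbb P)$-limit of integrals of step functions.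
   Formalization: X_t is taken as the integral of f_H(t,s) dL_s over all real s rather than over s ≤ t; the two agree for t ≥ 0, but for t < 0 the kernel is nonzero on (t,0) and with the integral cut off at t the claim fails for s < 0. *)

(* Defs.v *)
From mathcomp Require Import all_boot all_order all_algebra.
From mathcomp Require Import all_classical all_reals all_analysis.
Import Order.TTheory GRing.Theory Num.Theory.
Import numFieldNormedType.Exports.
Local Open Scope classical_set_scope.
Local Open Scope ring_scope.

Section Defs.
Context {d : measure_display} {T : measurableType d} {R : realType}.
Variable P : probability T R.

Definition cadlag_nonneg (f : R -> R) : Prop :=
  (forall t, 0 <= t -> f @ at_right t --> f t) /\
  (forall t, 0 < t -> cvg (f @ at_left t)).

(** mutual independence of finitely many real random variables
    (product rule for all measurable rectangles; taking some B i = setT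
    gives the product rule for every subfamily) *)
Definition mutually_indep {n : nat} (Y : 'I_n -> T -> R) : Prop :=
  forall B : 'I_n -> set R, (forall i, measurable (B i)) ->
    fine (P (\bigcap_(i in [set: 'I_n]) (Y i @^-1` B i))) =
    \prod_(i < n) fine (P (Y i @^-1` B i)).

Definition levy_process (L : R -> T -> R) : Prop :=
  [/\ (forall t, measurable_fun setT (L t)),
      {ae P, forall w, L 0 w = 0},
      (forall n (t : 'I_n.+1 -> R), 0 <= t ord0 ->
         (forall i j : 'I_n.+1, (i < j)%N -> t i < t j) ->
         mutually_indep (fun (i : 'I_n) w =>
           L (t (lift ord0 i)) w - L (t (widen_ord (leqnSn n) i)) w)),
      (forall s t, 0 <= s -> s <= t -> forall B : set R, measurable B ->
         P ((fun w => L t w - L s w) @^-1` B) = P (L (t - s) @^-1` B)) &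
      {ae P, forall w, cadlag_nonneg (fun t => L t w)}].

Definition fdd_event (L : R -> T -> R) {n} (s : 'I_n -> R) (A : 'I_n -> set R)
  : set T := \bigcap_(i in [set: 'I_n]) (L (s i) @^-1` A i).

Definition indep_processes (L1 L2 : R -> T -> R) : Prop :=
  forall n m (s : 'I_n -> R) (u : 'I_m -> R) (A : 'I_n -> set R)
         (B : 'I_m -> set R),
    (forall i, measurable (A i)) -> (forall j, measurable (B j)) ->
    fine (P (fdd_event L1 s A `&` fdd_event L2 u B)) =
    fine (P (fdd_event L1 s A)) * fine (P (fdd_event L2 u B)).

Definition same_law (L1 L2 : R -> T -> R) : Prop :=
  forall n (s : 'I_n -> R) (A : 'I_n -> set R), (forall i, measurable (A i)) ->
    P (fdd_event L1 s A) = P (fdd_event L2 s A).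

(** Lévy–Khintchine representation of the law of Y with zero Gaussian
    coefficient: E e^{iuY} = exp(i γ u + ∫ (e^{iux} - 1 - iux 1_{|x|<=1}) ν(dx)),
    written in real and imaginary parts; ν is a Lévy measure. *)
Definition no_gaussian_component (Y : T -> R) : Prop :=
  exists (gamma : R) (nu : {measure set R -> \bar R}),
    [/\ nu [set 0] = 0%E,
        (\int[nu]_x (Num.min 1 (x ^+ 2))%:E < +oo)%E &
        forall u : R,
          let A := Rintegral nu setT (fun x => cos (u * x) - 1) in
          let B := gamma * u +
                   Rintegral nu setT (fun x => sin (u * x) - (if `|x| <= 1 then u * x else 0)) in
          ('E_P[fun w => cos (u * Y w)] = (expR A * cos B)%:E)%E /\
          ('E_P[fun w => sin (u * Y w)] = (expR A * sin B)%:E)%E].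

End Defs.

Section Defs2.
Context {R : realType}.

Definition two_sided {T : Type} (L1 L2 : R -> T -> R) (t : R) (w : T) : R :=
  if 0 <= t then L1 t w else - lim ((fun u => L2 u w) @ at_left (- t)).

Definition C_H (H : R) : R :=
  powR (fine (\int[lebesgue_measure]_(s in [set x : R | (0 <= x)%R])
                 ((powR (1 + s) (H - 2^-1) - powR s (H - 2^-1)) ^+ 2)%:E)%E
        + (2 * H)^-1) (- 2^-1).

Definition f_H (H t s : R) : R :=
  C_H H * (powR (Num.max (t - s) 0) (H - 2^-1) - powR (Num.max (- s) 0) (H - 2^-1)).

(** step function  sum_k a_k 1_{(u_k, v_k]}  coded by a list of (a_k, u_k, v_k) *)
Definition step_fun (sq : seq (R * R * R)) (x : R) : R :=
  \sum_(p <- sq) p.1.1 * ((p.1.2 < x <= p.2)%R)%:R.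

Definition step_int {T : Type} (L : R -> T -> R) (sq : seq (R * R * R)) (w : T) : R :=
  \sum_(p <- sq) p.1.1 * (L p.2 w - L p.1.2 w).

End Defs2.

(** X_t = ∫_{-oo}^t f_H(t,s) dL_s, the integral being the L^2(P)-limit of the
    integrals of step functions converging to f_H(t,.) in L^2(R) *)
Definition fLpMvN {d : measure_display} {T : measurableType d} {R : realType}
  (P : probability T R) (H : R) (L X : R -> T -> R) : Prop :=
  forall t, measurable_fun setT (X t) /\
    exists sq : nat -> seq (R * R * R),
      [/\ forall n, all (fun p => p.1.2 <= p.2) (sq n),
          (fun n => (\int[lebesgue_measure]_x
                      ((step_fun (sq n) x - f_H H t x) ^+ 2)%:E)%E) @ \oo --> 0%E &
          (fun n => (\int[P]_w ((step_int L (sq n) w - X t w) ^+ 2)%:E)%E)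
             @ \oo --> 0%E].

(* Main.v *)
(** A mean-zero square-integrable Lévy process satisfies
    [E (L_u - L_v)^2 = |u - v| E L_1^2], and so does its two-sided version; by
    polarization the integral of step functions is therefore, up to the factor
    [E L_1^2], an isometry from L^2(R) to L^2(P).  Hence
    [E (X_t - X_s)^2 <= C int (f_H(t,x) - f_H(s,x))^2 dx <= C' (t - s)^(2H)],
    the second bound being obtained by splitting the line into the interval
    [s - (t - s), t] and dyadic shells to its left.  The sum over the dyadic
    partition of level n thus has expectation of order [2^(-n(2H - 1))]; these
    are summable, which forces almost sure convergence to 0. *)

Require Import Defs.
From HB Require Import structures.
From mathcomp Require Import all_boot all_order all_algebra.
From mathcomp Require Import all_classical all_reals all_analysis.
From mathcomp Require Import measurable_realfun ring lra.
Import Order.TTheory GRing.Theory Num.Theory.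
Import numFieldNormedType.Exports.
Local Open Scope classical_set_scope.
Local Open Scope ring_scope.

(** Moments are assumed at time 1 only, so [E L_t = 0] and [E L_t^2 = t E L_1^2] must be derived.
    The variance is additive in [t] and nonnegative, hence monotone and linear. The mean has no
    sign: additivity alone is Cauchy's equation, which has wild solutions, and right continuity of
    the paths at 0 is what forces it to vanish. A second obstacle is [two_sided], which for negative
    times takes left limits path by path and so need not be measurable as it stands. It is exchanged
    for a measurable version, equal to it almost surely at each fixed time because a Lévy process
    has no jump at a fixed time; integrals are compared by a monotonicity that asks measurability of
    the smaller function only. The isometry is proved once, for any family [F] whose increments have
    second moment [|u - v| c]. It applies to the process under [P] and to half-line indicators under
    Lebesgue measure, and comparing the two gives the factor [E L_1^2]. *)

Lemma nneseries_geometric_le {R : realType} (u : nat -> \bar R) (C r : R) :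
  0 <= C -> 0 < r < 1 -> (forall n, 0 <= u n)%E ->
  (forall n, u n <= (C * r ^+ n)%:E)%E ->
  (\big[+%E/0%R]_(0 <= n <oo) u n <= (C / (1 - r))%:E)%E.
Proof.
move=> C0 /andP[r0 r1] u0 uC; apply: lime_le.
  by apply: is_cvg_nneseries => n _ _; exact: u0.
apply: nearW => n.
apply: (@le_trans _ _ (series (geometric C r) n)%:E); last first.
  by rewrite lee_fin geometric_le_lim// ger0_norm// ltW.
by rewrite /series/= -sumEFin; apply: lee_sum => i _; exact: uC.
Qed.

(** * Monotonicity of integrals and almost everywhere convergence *)

Section integral_bounds.
Context {d : measure_display} {T : measurableType d} {R : realType}.
Variable mu : {measure set T -> \bar R}.

(* The integral of a nonnegative function is the supremum of the integrals of
   the simple functions below it, so monotonicity does not need measurability. *)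
Lemma ge0_le_integral_nonmeasurable (f g : T -> \bar R) :
  (forall x, 0 <= f x)%E -> (forall x, f x <= g x)%E ->
  (\int[mu]_x f x <= \int[mu]_x g x)%E.
Proof.
move=> f0 fg; rewrite !ge0_integralTE//; last first.
  by move=> x; exact: le_trans (f0 x) (fg x).
apply: le_ereal_sup => _ [h /= hf <-]; exists h => // x.
exact: le_trans (hf x) (fg x).
Qed.

(** Measurability of [f] lets the exceptional null set be removed without changing its integral; the
    restricted [f] then lies below [g] everywhere. *)
Lemma ae_ge0_le_integral_nonmeasurable (f g : T -> \bar R) :
  measurable_fun setT f -> (forall x, 0 <= f x)%E -> (forall x, 0 <= g x)%E ->
  {ae mu, forall x, (f x <= g x)%E} ->
  (\int[mu]_x f x <= \int[mu]_x g x)%E.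
Proof.
move=> mf f0 g0 [N [mN N0 fgN]].
rewrite (ge0_negligible_integral mN _ mf)//.
rewrite integral_mkcond; apply: ge0_le_integral_nonmeasurable => x.
  by apply: erestrict_ge0 => y _; exact: f0.
rewrite patchE; case: ifPn => // /set_mem[_ Nx].
by apply: contrapT => fgx; apply: Nx; exact: fgN.
Qed.

(** By monotone convergence the sum of all [f n] has finite integral, so it is finite almost
    everywhere, and the terms of a convergent series tend to 0. *)
Lemma ae_cvg0_geometric (f : nat -> T -> R) (C r : R) :
  (forall n, measurable_fun setT (f n)) -> (forall n w, 0 <= f n w) ->
  0 < r < 1 -> (forall n, \int[mu]_w (f n w)%:E <= (C * r ^+ n)%:E)%E ->
  {ae mu, forall w, f n w @[n --> \oo] --> 0}.
Proof.
move=> mf f0 /andP[r0 r1] fC.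
have mEf n : measurable_fun setT (fun w => (f n w)%:E).
  exact/measurable_EFinP.
have C0 : 0 <= C.
  rewrite -lee_fin; apply: le_trans (le_trans (fC 0%N) _).
    by apply: integral_ge0 => x _; rewrite lee_fin.
  by rewrite expr0 mulr1.
pose g w := (\big[+%E/0%R]_(0 <= n <oo) (f n w)%:E)%E.
have g0 w : (0 <= g w)%E.
  by apply: nneseries_ge0 => n _ _; rewrite lee_fin.
have mg : measurable_fun setT g.
  by apply: ge0_emeasurable_sum => // n x _ _; rewrite lee_fin.
have intg : (\int[mu]_w g w < +oo)%E.
  rewrite /g integral_nneseries//; last by move=> n x _; rewrite lee_fin.
  apply: (@le_lt_trans _ _ (C / (1 - r))%:E); last by rewrite ltry.
  apply: nneseries_geometric_le => //; first by rewrite r0.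
  by move=> n; apply: integral_ge0 => x _; rewrite lee_fin.
have ig : mu.-integrable setT g.
  apply/integrableP; split => //.
  by under eq_integral do rewrite gee0_abs//.
have := integrable_ae measurableT ig.
apply: filterS => w /(_ Logic.I) gw.
apply: cvg_series_cvg_0; apply: nnseries_is_cvg => //.
by rewrite -/(g w) ltey_eq gw.
Qed.

End integral_bounds.

(** * Square-integrable functions *)

Section second_moments.
Context {d : measure_display} {T : measurableType d} {R : realType}.

Definition sqint (mu : {measure set T -> \bar R}) (f : T -> R) : Prop :=
  measurable_fun setT f /\ (\int[mu]_x (f x ^+ 2)%:E < +oo)%E.

Variable mu : {measure set T -> \bar R}.

Lemma measurable_sqr (f : T -> R) : measurable_fun setT f ->
  measurable_fun setT (fun x => (f x ^+ 2)%:E).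
Proof. by move=> mf; apply/measurable_EFinP; exact: measurable_funX. Qed.

Lemma sqint_integrable_mul (f g : T -> R) : sqint mu f -> sqint mu g ->
  mu.-integrable setT (EFin \o (fun x => f x * g x)).
Proof.
move=> [mf if_] [mg ig]; apply/integrableP; split.
  by apply/measurable_EFinP; exact: measurable_funM.
apply: (@le_lt_trans _ _
  (\int[mu]_x ((f x ^+ 2)%:E + (g x ^+ 2)%:E))%E); last first.
  rewrite ge0_integralD//; last 4 first.
  - by move=> x _; rewrite lee_fin sqr_ge0.
  - exact: measurable_sqr.
  - by move=> x _; rewrite lee_fin sqr_ge0.
  - exact: measurable_sqr.
  exact: lte_add_pinfty.
apply: ge0_le_integral_nonmeasurable => x /=; first by rewrite lee_fin.
rewrite lee_fin ler_norml.
by apply/andP; split; nra.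
Qed.

Lemma sqint_integrable_sqr (f : T -> R) : sqint mu f ->
  mu.-integrable setT (EFin \o (fun x => f x ^+ 2)).
Proof. by move=> hf; have := sqint_integrable_mul f f hf hf. Qed.

Lemma sqint_integralE (f : T -> R) : sqint mu f ->
  (\int[mu]_x (f x ^+ 2)%:E)%E = (\int[mu]_x (f x ^+ 2))%:E.
Proof.
move=> hf; rewrite fineK//.
exact: (integrable_fin_num measurableT (sqint_integrable_sqr f hf)).
Qed.

Lemma integrable_sqint (f : T -> R) : measurable_fun setT f ->
  mu.-integrable setT (EFin \o (fun x => f x ^+ 2)) -> sqint mu f.
Proof.
move=> mf /integrableP[_ h]; split => //; apply: le_lt_trans h.
apply: ge0_le_integral_nonmeasurable => x; rewrite lee_fin ?sqr_ge0//.
by rewrite ger0_norm ?sqr_ge0.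
Qed.

Lemma sqintD (f g : T -> R) : sqint mu f -> sqint mu g ->
  sqint mu (fun x => f x + g x).
Proof.
move=> hf hg; have [mf _] := hf; have [mg _] := hg.
apply: integrable_sqint; first exact: measurable_funD.
have -> : EFin \o (fun x => (f x + g x) ^+ 2) =
    ((EFin \o (fun x => f x ^+ 2)%R) \+ (EFin \o (fun x => f x * g x)%R)
     \+ ((EFin \o (fun x => f x * g x)%R) \+ (EFin \o (fun x => g x ^+ 2)%R)))%E.
  by apply/funext => x /=; rewrite -!EFinD; congr EFin; ring.
by do 2?[apply: integrableD => //];
  (exact: sqint_integrable_sqr || exact: sqint_integrable_mul).
Qed.

Lemma sqintZ (c : R) (f : T -> R) : sqint mu f -> sqint mu (fun x => c * f x).
Proof.
move=> hf; have [mf _] := hf.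
apply: integrable_sqint; first exact: measurable_funM.
have -> : EFin \o (fun x => (c * f x) ^+ 2) =
    (fun x => (c ^+ 2)%:E * ((EFin \o (fun x => f x ^+ 2)%R) x))%E.
  by apply/funext => x /=; rewrite -EFinM exprMn.
by apply: integrableZl => //; exact: sqint_integrable_sqr.
Qed.

Lemma sqintB (f g : T -> R) : sqint mu f -> sqint mu g ->
  sqint mu (fun x => f x - g x).
Proof.
move=> hf /(sqintZ (-1)) hg; have := sqintD _ _ hf hg.
by under eq_fun do rewrite mulN1r.
Qed.

Lemma sqint0 : sqint mu (cst 0).
Proof.
split=> //; under eq_integral do rewrite /= expr0n/=.
by rewrite integral0 ltry.
Qed.

End second_moments.

(** * Independent pairs and second moments of sums *)

Section independence.
Context {d : measure_display} {T : measurableType d} {R : realType}.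
Variable P : probability T R.

Definition indep_pair (Y Z : T -> R) : Prop :=
  forall A B : set R, measurable A -> measurable B ->
    P (Y @^-1` A `&` Z @^-1` B) = (P (Y @^-1` A) * P (Z @^-1` B))%E.

(** Independence says that the law of [(Y, Z)] agrees with the product of the laws on rectangles;
    uniqueness of the product measure and Tonelli do the rest. *)
Lemma indep_tonelli (Y Z : T -> R) (g : R * R -> \bar R) :
  measurable_fun setT Y -> measurable_fun setT Z -> indep_pair Y Z ->
  measurable_fun setT g -> (forall x, 0 <= g x)%E ->
  (\int[P]_w g (Y w, Z w) = \int[P]_x \int[P]_y g (Y x, Z y))%E.
Proof.
move=> mY mZ YZ mg g0.
pose Y' : {mfun T >-> R} := HB.pack Y (isMeasurableFun.Build _ _ _ _ _ mY).
pose Z' : {mfun T >-> R} := HB.pack Z (isMeasurableFun.Build _ _ _ _ _ mZ).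
have mYZ : measurable_fun setT (fun w => (Y w, Z w)).
  exact: measurable_fun_pair.
pose W : {mfun T >-> (R * R)%type} :=
  HB.pack (fun w => (Y w, Z w)) (isMeasurableFun.Build _ _ _ _ _ mYZ).
have -> : (\int[P]_w g (Y w, Z w) = \int[distribution P W]_z g z)%E.
  by rewrite ge0_integral_distribution.
have -> : (\int[distribution P W]_z g z =
    \int[distribution P Y' \x distribution P Z']_z g z)%E.
  apply: eq_measure_integral => A mA _; apply/esym.
  exact: product_measure_unique.
rewrite fubini_tonelli1// ge0_integral_distribution//; last 2 first.
- exact: measurable_fun_fubini_tonelli_F.
- by move=> y; apply: integral_ge0.
apply: eq_integral => x _ /=; rewrite /fubini_F.
rewrite ge0_integral_distribution//.
by apply: measurableT_comp mg _; exact: measurable_pair1.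
Qed.

Lemma sqint_cst (c : R) : sqint P (cst c).
Proof.
split => //=; rewrite integral_cst//= probability_setT mule1.
exact: ltry.
Qed.

Lemma expectation_const (c : R) : \int[P]_w c = c.
Proof.
by rewrite Rintegral_cst//= probability_setT mulr1.
Qed.

Lemma sqint_integrable (Y : T -> R) : sqint P Y ->
  P.-integrable setT (EFin \o Y).
Proof.
move=> hY; have := sqint_integrable_mul P Y (cst 1) hY (sqint_cst 1).
by under eq_fun do rewrite mulr1.
Qed.

Lemma measurable_sqrD2 :
  measurable_fun setT (fun z : R * R => ((z.1 + z.2) ^+ 2)%:E).
Proof.
apply/measurable_EFinP; apply: measurable_funX.
by apply: measurable_funD; [exact: measurable_fst|exact: measurable_snd].
Qed.

(** By Tonelli, [E (Y x + Z)^2] is finite for at least one outcome [x]; there [Y x] is a constant,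
    which can be subtracted. *)
Lemma indep_sqint (Y Z : T -> R) :
  measurable_fun setT Y -> measurable_fun setT Z -> indep_pair Y Z ->
  sqint P (fun w => Y w + Z w) -> sqint P Z.
Proof.
move=> mY mZ YZ [_ h].
have := indep_tonelli Y Z _ mY mZ YZ measurable_sqrD2.
move=> /(_ (fun x => _)) /= E.
have {}E := E (fun x => sqr_ge0 (x.1 + x.2)).
rewrite E in h.
have [x hx] : exists x, (\int[P]_y ((Y x + Z y) ^+ 2)%:E < +oo)%E.
  apply: contrapT => /forallNP nx.
  have : (\int[P]_x cst +oo x <= \int[P]_x \int[P]_y ((Y x + Z y) ^+ 2)%:E)%E.
    apply: ge0_le_integral_nonmeasurable => x /=; first by [].
    by have /negP := nx x; rewrite -leNgt.
  rewrite integral_cst//= probability_setT mule1 leye_eq => /eqP e.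
  by rewrite e in h.
have sx : sqint P (fun y => Y x + Z y).
  by split => //; exact: measurable_funD.
have := sqintB P _ _ sx (sqint_cst (Y x)).
by under eq_fun do rewrite /= addrC addKr.
Qed.

Lemma Rintegral_sqrD (Y Z : T -> R) : sqint P Y -> sqint P Z ->
  \int[P]_w (Y w + Z w) ^+ 2 =
  \int[P]_w Y w ^+ 2 + 2 * \int[P]_w (Y w * Z w) + \int[P]_w Z w ^+ 2.
Proof.
move=> hY hZ.
have iYZ := sqint_integrable_mul P _ _ hY hZ.
have iY := sqint_integrable_sqr P _ hY.
have iZ := sqint_integrable_sqr P _ hZ.
have i2 : P.-integrable setT (EFin \o (fun w => 2 * (Y w * Z w))).
  have -> : EFin \o (fun w => 2 * (Y w * Z w)) =
    (fun w => 2%:E * (EFin \o (fun w => Y w * Z w)%R) w)%E.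
    by apply/funext => w.
  exact: integrableZl.
rewrite -RintegralZl// -RintegralD// -RintegralD//; last first.
  exact: (integrableD measurableT iY i2).
by apply: eq_Rintegral => w _; ring.
Qed.

(** Tonelli is applied to the nonnegative [(Y + Z)^2], integrating in [Z] first, since the product
    [Y Z] may change sign. *)
Lemma indep_Rintegral_sqrD (Y Z : T -> R) : indep_pair Y Z ->
  sqint P Y -> sqint P Z ->
  \int[P]_w (Y w + Z w) ^+ 2 = \int[P]_w Y w ^+ 2
    + 2 * (\int[P]_w Y w) * (\int[P]_w Z w) + \int[P]_w Z w ^+ 2.
Proof.
move=> YZ hY hZ; have [mY _] := hY; have [mZ _] := hZ.
have inner x : (\int[P]_y ((Y x + Z y) ^+ 2)%:E =
   (Y x ^+ 2 + 2 * (Y x * \int[P]_w Z w) + \int[P]_w Z w ^+ 2)%:E)%E.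
  rewrite sqint_integralE; last exact: (sqintD P (cst (Y x))) (sqint_cst _) hZ.
  rewrite (Rintegral_sqrD (cst (Y x)))//; last exact: sqint_cst.
  congr ((_ + 2 * _ + _)%:E).
    exact: (expectation_const (Y x ^+ 2)).
  by rewrite RintegralZl//; exact: sqint_integrable.
apply: EFin_inj; rewrite -sqint_integralE; last exact: sqintD.
rewrite (indep_tonelli Y Z _ mY mZ YZ measurable_sqrD2); last first.
  by move=> x; rewrite lee_fin sqr_ge0.
under eq_integral do rewrite inner.
set c := (\int[P]_w Z w)%R; set v := (\int[P]_w Z w ^+ 2)%R.
have iY := sqint_integrable_sqr P _ hY.
have i1 := sqint_integrable _ hY.
have i2 : P.-integrable setT (EFin \o (fun w => 2 * c * Y w)).
  have -> : EFin \o (fun w => 2 * c * Y w) =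
    (fun w => (2 * c)%:E * (EFin \o Y) w)%E by apply/funext => w.
  exact: integrableZl.
have i3 : P.-integrable setT (EFin \o (fun w => Y w ^+ 2 + 2 * c * Y w)).
  exact: (integrableD measurableT iY i2).
have i4 : P.-integrable setT (EFin \o (cst v : T -> R)).
  exact: sqint_integrable (sqint_cst v).
have -> : (\int[P]_x (Y x ^+ 2 + 2 * (Y x * c) + v)%:E =
   \int[P]_x (EFin \o (fun x => (Y x ^+ 2 + 2 * c * Y x) + cst v x)%R) x)%E.
  by apply: eq_integral => x _ /=; congr EFin; rewrite /cst; ring.
rewrite -[LHS]fineK; last first.
  by apply: integrable_fin_num => //; exact: (integrableD measurableT i3 i4).
congr EFin; rewrite -/(Rintegral _ _ _) RintegralD// RintegralD// RintegralZl//.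
rewrite (expectation_const v); ring.
Qed.

End independence.

(** * Transfer of moments between variables of equal law *)

Section equality_in_law.
Context {d : measure_display} {T : measurableType d} {R : realType}.
Variable P : probability T R.

Definition eq_law (Y Z : T -> R) : Prop :=
  forall B : set R, measurable B -> P (Y @^-1` B) = P (Z @^-1` B).

Lemma eq_law_integral (Y Z : T -> R) (g : R -> \bar R) :
  measurable_fun setT Y -> measurable_fun setT Z -> eq_law Y Z ->
  measurable_fun setT g ->
  (\int[P]_w g (Y w) = \int[P]_w g (Z w))%E.
Proof.
move=> mY mZ YZ.
have pos (h : R -> \bar R) : measurable_fun setT h -> (forall x, 0 <= h x)%E ->
    (\int[P]_w h (Y w) = \int[P]_w h (Z w))%E.
  move=> mh h0.
  pose Y' : {mfun T >-> R} := HB.pack Y (isMeasurableFun.Build _ _ _ _ _ mY).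
  pose Z' : {mfun T >-> R} := HB.pack Z (isMeasurableFun.Build _ _ _ _ _ mZ).
  have := @ge0_integral_distribution _ _ _ _ _ P Y' h mh h0; rewrite /= => <-.
  have := @ge0_integral_distribution _ _ _ _ _ P Z' h mh h0; rewrite /= => <-.
  by apply: eq_measure_integral => A mA _; exact: YZ.
move=> mg; rewrite integralE [RHS]integralE; congr (_ - _)%E.
  by have := pos (g ^\+)%E (measurable_funepos mg) (funepos_ge0 g); rewrite unlock.
by have := pos (g ^\-)%E (measurable_funeneg mg) (funeneg_ge0 g); rewrite unlock.
Qed.

Lemma eq_law_mean (Y Z : T -> R) :
  measurable_fun setT Y -> measurable_fun setT Z -> eq_law Y Z ->
  \int[P]_w Y w = \int[P]_w Z w.
Proof.
by move=> mY mZ YZ; congr fine; apply: (eq_law_integral Y Z EFin).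
Qed.

Lemma eq_law_sqr (Y Z : T -> R) :
  measurable_fun setT Y -> measurable_fun setT Z -> eq_law Y Z ->
  (\int[P]_w (Y w ^+ 2)%:E = \int[P]_w (Z w ^+ 2)%:E)%E.
Proof.
move=> mY mZ YZ; apply: (eq_law_integral Y Z (fun x => (x ^+ 2)%:E)) => //.
by apply: measurable_sqr.
Qed.

Lemma eq_law_sqint (Y Z : T -> R) :
  measurable_fun setT Y -> measurable_fun setT Z -> eq_law Y Z ->
  sqint P Y -> sqint P Z.
Proof. by move=> mY mZ YZ [_ h]; split => //; rewrite -(eq_law_sqr Y). Qed.

End equality_in_law.

(** Nonnegativity makes [W] monotone. Trapping [n t] between consecutive integers bounds
    [n |W t - t W 1|] by [W 1] for every [n], so the difference is 0. *)
Lemma additive_nonneg_linear {R : realType} (W : R -> R) :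
  (forall s u, 0 <= s -> 0 <= u -> W (s + u) = W s + W u) ->
  (forall s, 0 <= s -> 0 <= W s) ->
  forall t, 0 <= t -> W t = t * W 1.
Proof.
move=> WD W0 t t0.
have Wn s n : 0 <= s -> W (n%:R * s) = n%:R * W s.
  move=> s0; elim: n => [|n IH].
    rewrite !mul0r; have := WD 0 0 (lexx _) (lexx _); rewrite addr0; lra.
  rewrite -natr1 mulrDl mul1r WD//; first by rewrite IH; ring.
  by rewrite mulr_ge0.
have Wle s u : 0 <= s -> s <= u -> W s <= W u.
  move=> s0 su; rewrite -(subrK s u) WD ?subr_ge0//.
  by rewrite lerDr W0// subr_ge0.
have key n : (n%:R * `|W t - t * W 1| <= W 1).
  have nt0 : 0 <= n%:R * t by rewrite mulr_ge0.
  have /andP[k1 k2] := truncn_itv nt0; set k := Num.truncn _ in k1 k2.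
  have h1 : k%:R * W 1 <= n%:R * W t.
    by rewrite -Wn// -Wn// Wle// mulr1.
  have h2 : n%:R * W t <= k.+1%:R * W 1.
    by rewrite -Wn// -Wn// Wle// mulr1 ltW.
  have W1 := W0 1 ler01.
  rewrite -[n%:R]ger0_norm// -normrM ler_norml; apply/andP; split.
    have : k.+1%:R * W 1 - W 1 = k%:R * W 1 by rewrite -natr1; ring.
    have : n%:R * t * W 1 <= k.+1%:R * W 1 by rewrite ler_wpM2r// ltW.
    rewrite mulrBr mulrA; lra.
  have : k%:R * W 1 <= n%:R * t * W 1 by rewrite ler_wpM2r.
  have : k.+1%:R * W 1 - W 1 = k%:R * W 1 by rewrite -natr1; ring.
  rewrite mulrBr mulrA; lra.
apply/eqP; rewrite -subr_eq0 -normr_le0 leNgt; apply/negP => e0.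
have := key (Num.truncn (W 1 / `|W t - t * W 1|)).+1.
apply/negP; rewrite -ltNge -ltr_pdivrMr//.
by have /andP[] := truncn_itv (divr_ge0 (W0 1 ler01) (ltW e0)).
Qed.

(** * Mean and variance of a one-sided Lévy process *)

Section levy_moments.
Context {d : measure_display} {T : measurableType d} {R : realType}.
Variables (P : probability T R) (L : R -> T -> R).
Hypothesis levyL : levy_process P L.

Lemma levy_measurable t : measurable_fun setT (L t).
Proof. by have [] := levyL. Qed.

Lemma levy_measurableB s t : measurable_fun setT (fun w => L t w - L s w).
Proof. by apply: measurable_funB; exact: levy_measurable. Qed.

Lemma levy_stationary s t : 0 <= s -> s <= t ->
  eq_law P (fun w => L t w - L s w) (L (t - s)).
Proof. by move=> s0 st B mB; have [_ _ _ h _] := levyL; exact: h. Qed.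

(** [L 0] vanishes only almost surely; passing through laws avoids carrying that null set along. *)
Lemma levy_stationary0 t : 0 <= t -> eq_law P (fun w => L t w - L 0 w) (L t).
Proof. by move=> t0 B mB; rewrite levy_stationary// subr0. Qed.

Lemma levy_indep s t : 0 < s -> s < t ->
  indep_pair P (fun w => L s w - L 0 w) (fun w => L t w - L s w).
Proof.
move=> s0 st A B mA mB; have [_ _ h _ _] := levyL.
pose tt (i : 'I_3) : R :=
  if val i == 0%N then 0 else if val i == 1%N then s else t.
pose C (i : 'I_2) := if val i == 0%N then A else B.
have tt_incr (i j : 'I_3) : (i < j)%N -> tt i < tt j.
  case: i j => [[|[|[|i]]] hi] [[|[|[|j]]] hj] //= _; rewrite /tt//=.
  exact: lt_trans st.
have mC i : measurable (C i) by rewrite /C; case: ifP.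
have H := h 2%N tt (lexx _) tt_incr C mC.
have PfinE (D : set T) : measurable D -> P D = (fine (P D))%:E.
  by move=> mD; rewrite fineK// fin_num_measure.
have mY : measurable ((fun w => L s w - L 0 w) @^-1` A).
  by rewrite -[X in measurable X]setTI; exact: levy_measurableB.
have mZ : measurable ((fun w => L t w - L s w) @^-1` B).
  by rewrite -[X in measurable X]setTI; exact: levy_measurableB.
rewrite (PfinE _ mY) (PfinE _ mZ) (PfinE (_ `&` _)); last exact: measurableI.
rewrite -EFinM; congr EFin.
move: H; rewrite !big_ord_recl big_ord0 mulr1 => H.
etransitivity; last exact: H.
congr (fine (P _)); apply/seteqP; split => w.
  by move=> [wA wB] [[|[|i]] hi].
by move=> wH; split; [exact: (wH ord0)|exact: (wH (lift ord0 ord0))].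
Qed.

Hypotheses (L1sq : sqint P (L 1)) (L1mean : \int[P]_w L 1 w = 0).

(** For [0 < u < 1], [L 1 - L 0] splits into independent increments over [[0, 1 - u]] and
    [[1 - u, 1]]; the second has the law of [L u] and inherits square integrability by
    [indep_sqint]. Longer times are reached by unit steps. *)
Lemma levy_sqint t : 0 <= t -> sqint P (L t).
Proof.
have lt1 u : 0 <= u -> u <= 1 -> sqint P (L u).
  rewrite le_eqVlt => /predU1P[<- _|u0].
    apply: (@eq_law_sqint _ _ _ P (fun w => L 0 w - L 0 w)).
    - exact: levy_measurableB.
    - exact: levy_measurable.
    - exact: levy_stationary0.
    - by have := sqint0 P; congr sqint; apply/funext => w; rewrite subrr.
  rewrite le_eqVlt => /predU1P[->//|u1].
  apply: (@eq_law_sqint _ _ _ P (fun w => L 1 w - L (1 - u) w)).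
  - exact: levy_measurableB.
  - exact: levy_measurable.
  - by have := @levy_stationary (1 - u) 1; rewrite subKr; apply; lra.
  - apply: (@indep_sqint _ _ _ P (fun w => L (1 - u) w - L 0 w)).
    + exact: levy_measurableB.
    + exact: levy_measurableB.
    + by apply: levy_indep; lra.
    + apply: (@eq_law_sqint _ _ _ P (L 1)) => //.
      * exact: levy_measurable.
      * apply: measurable_funD; exact: levy_measurableB.
      * rewrite (_ : (fun w => _) = (fun w => L 1 w - L 0 w)); last first.
          by apply/funext => w; ring.
        by move=> B mB; rewrite levy_stationary0.
suff H n : forall u, 0 <= u -> u <= n.+1%:R -> sqint P (L u).
  move=> t0; apply: (H (Num.truncn t)) => //.
  by have /andP[_ /ltW] := truncn_itv t0.
elim: n => [u u0 u1|n IH u u0 un]; first exact: lt1.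
have [un'|un'] := leP u n.+1%:R; first exact: IH.
have -> : L u = (fun w => (L u w - L n.+1%:R w) + L n.+1%:R w).
  by apply/funext => w; rewrite subrK.
apply: sqintD; last by apply: IH.
apply: (@eq_law_sqint _ _ _ P (L (u - n.+1%:R))).
- exact: levy_measurable.
- exact: levy_measurableB.
- by move=> B mB; rewrite levy_stationary// ltW.
- by apply: lt1; [rewrite subr_ge0 ltW|rewrite lerBlDl natr1].
Qed.

Local Notation M t := (\int[P]_w L t w).
Local Notation V t := (\int[P]_w L t w ^+ 2).

Lemma levy_meanD s u : 0 <= s -> 0 <= u -> M (s + u) = M s + M u.
Proof.
move=> s0 u0.
have su : s <= s + u by rewrite lerDl.
have hs := levy_sqint _ s0; have hsu := levy_sqint _ (addr_ge0 s0 u0).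
have -> : M u = \int[P]_w (L (s + u) w - L s w).
  apply/esym/eq_law_mean; [exact: levy_measurableB|exact: levy_measurable|].
  by have := @levy_stationary s (s + u) s0 su; rewrite [s + u - s]addrAC subrr add0r.
rewrite -RintegralD//; last 2 first.
- exact: sqint_integrable.
- by apply: (sqint_integrable P (fun w => L (s + u) w - L s w)); exact: sqintB.
by apply: eq_Rintegral => w _; ring.
Qed.

Lemma levy_mean0 : M 0 = 0.
Proof. by have := levy_meanD 0 0 (lexx _) (lexx _); rewrite addr0; lra. Qed.

(** The cross term stays because the means are not yet known to vanish. *)
Lemma levy_sqrD s u : 0 <= s -> 0 <= u ->
  V (s + u) = V s + 2 * M s * M u + V u.
Proof.
have sqrE Y Z : measurable_fun setT Y -> measurable_fun setT Z ->
    eq_law P Y Z -> \int[P]_w Y w ^+ 2 = \int[P]_w Z w ^+ 2.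
  by move=> mY mZ YZ; congr fine; exact: eq_law_sqr.
have V0 : V 0 = 0.
  rewrite -(sqrE (fun w => L 0 w - L 0 w)); last 3 first.
  - exact: levy_measurableB.
  - exact: levy_measurable.
  - exact: levy_stationary0.
  under eq_Rintegral do rewrite subrr expr0n/=.
  exact: expectation_const.
(* Independence of increments is stated for strictly increasing times, so [s = 0] and [u = 0] are
   treated apart. *)
rewrite le_eqVlt => /predU1P[<- _|s0].
  by rewrite add0r V0 levy_mean0 mulr0 mul0r !add0r.
rewrite le_eqVlt => /predU1P[<-|u0].
  by rewrite addr0 V0 levy_mean0 mulr0 !addr0.
have su : s < s + u by rewrite ltrDl.
have s0' := ltW s0; have u0' := ltW u0.
have law1 := levy_stationary0 _ s0'.
have law2 : eq_law P (fun w => L (s + u) w - L s w) (L u).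
  by have := @levy_stationary s (s + u) s0' (ltW su); rewrite [s + u - s]addrAC subrr add0r.
have mB := levy_measurableB; have mL := levy_measurable.
rewrite -(eq_law_mean P _ _ (mB _ _) (mL _) law1).
rewrite -(eq_law_mean P _ _ (mB _ _) (mL _) law2).
rewrite -(sqrE _ _ (mB _ _) (mL _) law1) -(sqrE _ _ (mB _ _) (mL _) law2).
rewrite -(sqrE _ _ (mB _ _) (mL _) (levy_stationary0 _ (addr_ge0 s0' u0'))).
rewrite -indep_Rintegral_sqrD.
- by apply: eq_Rintegral => w _; congr (_ ^+ 2); ring.
- exact: levy_indep.
- apply: sqintB; exact: levy_sqint.
- by apply: sqintB; apply: levy_sqint => //; exact: addr_ge0.
Qed.

(** The cross term of [levy_sqrD] is absorbed by the square of the additive mean, so the variance is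
    additive as well as nonnegative. *)
Lemma levy_var_linear t : 0 <= t -> V t - M t ^+ 2 = t * V 1.
Proof.
move=> t0; rewrite (additive_nonneg_linear (fun t => V t - M t ^+ 2))//.
- by rewrite L1mean expr0n/= subr0.
- by move=> s u s0 u0; rewrite levy_meanD// levy_sqrD//; ring.
- move=> s s0; have hs := levy_sqint _ s0.
  have : 0 <= \int[P]_w (L s w + cst (- M s) w) ^+ 2.
    by apply: Rintegral_ge0 => w _; exact: sqr_ge0.
  rewrite Rintegral_sqrD//; last exact: sqint_cst.
  rewrite RintegralZr//; last exact: sqint_integrable.
  rewrite (expectation_const P ((- M s) ^+ 2)); nra.
Qed.

End levy_moments.

(** * Vanishing of the mean at every time *)

Section levy_mean_zero.
Context {d : measure_display} {T : measurableType d} {R : realType}.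
Variables (P : probability T R) (L : R -> T -> R).
Hypotheses (levyL : levy_process P L) (L1sq : sqint P (L 1))
  (L1mean : \int[P]_w L 1 w = 0).

Lemma levy_mean_dyadic k n : \int[P]_w L (k%:R / 2 ^+ n) w = 0.
Proof.
have mulM m s : 0 <= s -> \int[P]_w L (m%:R * s) w = m%:R * \int[P]_w L s w.
  move=> s0; elim: m => [|m IH]; first by rewrite !mul0r levy_mean0.
  by rewrite -natr1 mulrDl mul1r levy_meanD// ?mulr_ge0// IH; ring.
have s0 : 0 <= k%:R / 2 ^+ n :> R by rewrite divr_ge0.
have := mulM (2 ^ n)%N _ s0; rewrite natrX mulrC divfK ?expf_neq0//.
have := mulM k 1 ler01; rewrite mulr1 => ->; rewrite L1mean mulr0.
by move/esym/eqP; rewrite mulf_eq0 expf_eq0/= pnatr_eq0 andbF/= => /eqP.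
Qed.

(* Subtracting dyadics replaces [t] by [t - q n <= 2^-n] with the same mean [M];
   [L (t - q n) - M] tends to 0 by the variance bound, and [L (t - q n)] by right
   continuity at 0, whence [M = 0]. *)
Lemma levy_mean t : 0 <= t -> \int[P]_w L t w = 0.
Proof.
move=> t0; set M := \int[P]_w L t w.
pose q n : R := (Num.truncn (2 ^+ n * t))%:R / 2 ^+ n.
have tn_itv n : 0 <= t - q n /\ t - q n <= 2^-1 ^+ n.
  have e0 : 0 < 2 ^+ n :> R by rewrite exprn_gt0.
  have /andP[h1 h2] := truncn_itv (mulr_ge0 (ltW e0) t0).
  split; rewrite /q.
    by rewrite subr_ge0 ler_pdivrMr// [t * _]mulrC.
  rewrite exprVn lerBlDl -{2}[(2 ^+ n)^-1]mul1r -mulrDl natr1 ler_pdivlMr// [t * _]mulrC.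
  exact: ltW.
have q0 n : 0 <= q n by rewrite divr_ge0// exprn_ge0.
have Mq n : \int[P]_w L (q n) w = 0 by exact: levy_mean_dyadic.
have ML n : \int[P]_w L (t - q n) w = M.
  have [h _] := tn_itv n.
  have := levy_meanD _ _ levyL L1sq _ _ h (q0 n).
  by rewrite subrK Mq addr0.
(* The filter [0^'+] excludes 0 itself, so the case where some [q n] equals [t] is settled first. *)
have [[n tn0]|tn0] := pselect (exists n, t - q n = 0).
  by rewrite -(ML n) tn0 levy_mean0.
have tn_gt0 n : 0 < t - q n.
  have [h _] := tn_itv n; rewrite lt_neqAle h andbT eq_sym.
  by apply/eqP => e; apply: tn0; exists n.
have cv_tn : t - q n @[n --> \oo] --> 0^'+.
  have c0 : t - q n @[n --> \oo] --> (0 : R).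
    apply: (@squeeze_cvgr _ _ _ _ (fun=> 0) (fun n => 2^-1 ^+ n)).
    - by apply: nearW => n; have [-> ->] := tn_itv n.
    - exact: cvg_cst.
    - by apply: cvg_expr; rewrite ger0_norm ?invr_ge0// invf_lt1// ltr1n.
  move=> A /= [e /= e0 eA].
  have /cvgrPdist_lt/(_ e e0) := c0.
  apply: filterS => n /= ne; apply: eA => //=; exact: tn_gt0.
have ae1 : {ae P, forall w, (L (t - q n) w - M) ^+ 2 @[n --> \oo] --> 0}.
  apply: (@ae_cvg0_geometric _ _ _ P _ (\int[P]_w L 1 w ^+ 2) 2^-1).
  - move=> n; apply: measurable_funX; apply: measurable_funB => //.
    exact: levy_measurable levyL _.
  - by move=> n w; exact: sqr_ge0.
  - by rewrite invr_gt0 ltr0n/= invf_lt1// ltr1n.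
  - move=> n; have [h1 h2] := tn_itv n.
    have hs : sqint P (L (t - q n)) by exact: levy_sqint.
    rewrite sqint_integralE; last exact: sqintB hs (sqint_cst P M).
    rewrite lee_fin.
    have -> : \int[P]_w (L (t - q n) w - M) ^+ 2
        = \int[P]_w (L (t - q n) w + cst (- M) w) ^+ 2 by [].
    rewrite Rintegral_sqrD//; last exact: sqint_cst.
    rewrite RintegralZr//; last exact: sqint_integrable.
    rewrite (expectation_const P ((- M) ^+ 2)) ML.
    have := levy_var_linear _ _ levyL L1sq L1mean _ h1; rewrite ML.
    set v := \int[P]_w L 1 w ^+ 2 => vE.
    have v0 : 0 <= v by apply: Rintegral_ge0 => w _; exact: sqr_ge0.
    have : (t - q n) * v <= 2^-1 ^+ n * v by rewrite ler_wpM2r.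
    nra.
have [_ ae2 _ _ ae3] := levyL.
(* [M] is deterministic, so a single outcome satisfying the three almost sure properties decides its
   value. *)
have [w [[w1 w2] w3]] : exists w, ((L (t - q n) w - M) ^+ 2 @[n --> \oo] --> 0
    /\ L 0 w = 0) /\ cadlag_nonneg (fun t => L t w).
  have ae_proper : ProperFilter (almost_everywhere P).
    have PT : (0 < P setT)%E by rewrite probability_setT lte_fin.
    exact: ae_properfilter_algebraOfSetsType PT.
  apply: (@filter_ex _ (almost_everywhere P)).
  by move: ae1 ae2 ae3; apply: filterS3 => w ? ? ?.
have [/(_ 0 (lexx _)) rc _] := w3.
have c1 : L (t - q n) w @[n --> \oo] --> L 0 w := cvg_comp _ _ cv_tn rc.
rewrite w2 in c1.
have c2 : (L (t - q n) w - M) ^+ 2 @[n --> \oo] --> (0 - M) ^+ 2.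
  by apply: cvgM; apply: cvgB => //; exact: cvg_cst.
have e : (0 - M) ^+ 2 = 0.
  by rewrite -(cvg_lim (@Rhausdorff R) c2) (cvg_lim (@Rhausdorff R) w1).
by move/eqP: e; rewrite sub0r sqrrN expf_eq0/= => /eqP.
Qed.

Lemma levy_sqr t : 0 <= t ->
  \int[P]_w L t w ^+ 2 = t * \int[P]_w L 1 w ^+ 2.
Proof.
move=> t0; have := levy_var_linear _ _ levyL L1sq L1mean _ t0.
by rewrite levy_mean// expr0n/= subr0.
Qed.

End levy_mean_zero.

(** * Increments and absence of jumps at a fixed time *)

Section levy_increments.
Context {d : measure_display} {T : measurableType d} {R : realType}.
Variables (P : probability T R) (L : R -> T -> R).
Hypotheses (levyL : levy_process P L) (L1sq : sqint P (L 1))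
  (L1mean : \int[P]_w L 1 w = 0).

Lemma levy_increment_sqr u v : 0 <= u -> 0 <= v ->
  \int[P]_w (L u w - L v w) ^+ 2 = `|u - v| * \int[P]_w L 1 w ^+ 2.
Proof.
wlog vu : u v / v <= u.
  move=> h u0 v0; have [vu|/ltW uv] := leP v u; first exact: h.
  by rewrite distrC -h//; apply: eq_Rintegral => w _; ring.
move=> u0 v0; rewrite ger0_norm ?subr_ge0// -(levy_sqr _ _ levyL)// ?subr_ge0//.
congr fine; apply: eq_law_sqr.
- exact: (levy_measurableB P L levyL).
- exact: (levy_measurable P L levyL).
- exact: levy_stationary.
Qed.

(** Paths have a left limit at [u], which can be read off along one sequence. Along [t n] the second
    moments of [L u - L (t n)] decay geometrically, so almost surely that limit is [L u]. *)
Lemma levy_left_limit (u : R) : 0 < u ->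
  {ae P, forall w, lim (L t w @[t --> u^'-]) = L u w}.
Proof.
move=> u0; set s2 := \int[P]_w L 1 w ^+ 2.
(* The exponent [n.+1] keeps [t 0 = u / 2] strictly positive. *)
pose t n : R := u - u * 2^-1 ^+ n.+1.
have h0 n : 0 < 2^-1 ^+ n :> R by rewrite exprn_gt0// invr_gt0.
have tu n : t n < u by rewrite ltrBlDr ltrDl mulr_gt0.
have h1 n : 2^-1 ^+ n.+1 < 1 :> R.
  by rewrite exprn_ilt1// ?invf_lt1// ?invr_ge0// ltr1n.
have t0 n : 0 < t n by rewrite subr_gt0 gtr_pMr.
have cv_t : t n @[n --> \oo] --> u^'-.
  have c0 : t n @[n --> \oo] --> u.
    rewrite -[X in _ --> X](subr0 u) -(mulr0 u).
    apply: cvgB; first exact: cvg_cst.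
    apply: cvgM; first exact: cvg_cst.
    rewrite (cvg_shiftS (fun n => 2^-1 ^+ n : R)).
    by apply: cvg_expr; rewrite ger0_norm ?invr_ge0// invf_lt1// ltr1n.
  move=> A /= [e /= e0 eA].
  have /cvgrPdist_lt/(_ e e0) := c0.
  by apply: filterS => n /= ne; apply: eA => //=; exact: tu.
have ae1 : {ae P, forall w, (L u w - L (t n) w) ^+ 2 @[n --> \oo] --> 0}.
  apply: (@ae_cvg0_geometric _ _ _ P _ (u * s2) 2^-1).
  - move=> n; apply: measurable_funX; exact: (levy_measurableB P L levyL).
  - by move=> n w; exact: sqr_ge0.
  - by rewrite invr_gt0 ltr0n/= invf_lt1// ltr1n.
  - move=> n; rewrite sqint_integralE; last first.
      by apply: sqintB; apply: levy_sqint => //; exact: ltW.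
    rewrite lee_fin levy_increment_sqr ?(ltW u0) ?(ltW (t0 n))// -/s2.
    rewrite ger0_norm ?subr_ge0 ?(ltW (tu n))// /t subKr mulrAC.
    have v0 : 0 <= s2 by apply: Rintegral_ge0 => w _; exact: sqr_ge0.
    apply: ler_wpM2l; first by rewrite mulr_ge0// ltW.
    by rewrite exprS ler_piMl ?ltW// invf_lt1// ltr1n.
have [_ _ _ _ ae2] := levyL.
move: ae1 ae2; apply: filterS2 => w w1 [_ /(_ u u0) w2].
set l := lim _.
have c1 : L (t n) w @[n --> \oo] --> l := cvg_comp _ _ cv_t w2.
have c2 : (L u w - L (t n) w) ^+ 2 @[n --> \oo] --> (L u w - l) ^+ 2.
  by apply: cvgM; apply: cvgB => //; exact: cvg_cst.
have e : (L u w - l) ^+ 2 = 0.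
  by rewrite -(cvg_lim (@Rhausdorff R) c2) (cvg_lim (@Rhausdorff R) w1).
by move/eqP: e; rewrite expf_eq0/= subr_eq0 => /eqP.
Qed.

End levy_increments.

(** * The two-sided process *)

Section two_sided_levy.
Context {d : measure_display} {T : measurableType d} {R : realType}.
Variables (P : probability T R) (L1 L2 : R -> T -> R).

(* Almost surely equal to [two_sided L1 L2 t], but measurable. *)
Definition two_sided_version (t : R) (w : T) : R :=
  if 0 <= t then L1 t w else - L2 (- t) w.

Hypotheses (levyL1 : levy_process P L1) (levyL2 : levy_process P L2).
Hypothesis indepL : indep_processes P L1 L2.
Hypotheses (sqL1 : sqint P (L1 1)) (sqL2 : sqint P (L2 1)).
Hypotheses (meanL1 : \int[P]_w L1 1 w = 0) (meanL2 : \int[P]_w L2 1 w = 0).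
Hypothesis eq_sqr : \int[P]_w L2 1 w ^+ 2 = \int[P]_w L1 1 w ^+ 2.

Lemma two_sided_ae t :
  {ae P, forall w, two_sided L1 L2 t w = two_sided_version t w}.
Proof.
rewrite /two_sided /two_sided_version; case: (boolP (0 <= t)) => t0.
  by apply: aeW => w.
have Nt0 : 0 < - t by rewrite oppr_gt0 ltNge.
have := levy_left_limit P L2 levyL2 sqL2 meanL2 (- t) Nt0.
by apply: filterS => w h; congr (- _).
Qed.

Lemma two_sided_version_sqint t : sqint P (two_sided_version t).
Proof.
rewrite /two_sided_version; case: (boolP (0 <= t)) => t0; first exact: levy_sqint.
have h : sqint P (L2 (- t)).
  by apply: levy_sqint => //; rewrite oppr_ge0 leNgt; apply: contraNN t0 => /ltW.
by have := sqintZ P (-1) _ h; under eq_fun do rewrite mulN1r.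
Qed.

Lemma indep_processes_pair u v : indep_pair P (L1 u) (L2 v).
Proof.
move=> A B mA mB.
have := indepL 1%N 1%N (fun=> u) (fun=> v) (fun=> A) (fun=> B)
  (fun=> mA) (fun=> mB).
have E (L : R -> T -> R) x C :
    fdd_event L (fun _ : 'I_1 => x) (fun=> C) = L x @^-1` C.
  by apply/seteqP; split => [w /(_ ord0)|w Cw i _]; [exact|].
rewrite !E.
have mY : measurable (L1 u @^-1` A).
  by rewrite -[X in measurable X]setTI; exact: (levy_measurable P L1 levyL1).
have mZ : measurable (L2 v @^-1` B).
  by rewrite -[X in measurable X]setTI; exact: (levy_measurable P L2 levyL2).
move=> H; rewrite -(@fineK _ (P (_ `&` _))) ?fin_num_measure//; last first.
  exact: measurableI.
by rewrite H EFinM !fineK// fin_num_measure.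
Qed.

(** Times of equal sign reduce to a one-sided process. For [v < 0 <= u] the increment is
    [L1 u + L2 (- v)], a sum of independent centred variables, and the variances [u] and [- v] add
    up to [u - v]. *)
Lemma two_sided_increment_sqr u v :
  \int[P]_w (two_sided_version u w - two_sided_version v w) ^+ 2
  = `|u - v| * \int[P]_w L1 1 w ^+ 2.
Proof.
wlog vu : u v / v <= u.
  move=> h; have [vu|/ltW uv] := leP v u; first exact: h.
  by rewrite distrC -h//; apply: eq_Rintegral => w _; ring.
rewrite /two_sided_version.
have [v0|v0] := leP 0 v.
  rewrite (le_trans v0 vu); apply: levy_increment_sqr => //.
  exact: le_trans vu.
have Nv0 : 0 <= - v by rewrite oppr_ge0 ltW.
have [u0|u0] := leP 0 u; last first.
  have Nu0 : 0 <= - u by rewrite oppr_ge0 ltW.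
  rewrite -eq_sqr (_ : u - v = - v - - u); last by ring.
  rewrite -(levy_increment_sqr P L2)//.
  by apply: eq_Rintegral => w _; congr (_ ^+ 2); ring.
under eq_Rintegral do rewrite opprK.
rewrite indep_Rintegral_sqrD; last 3 first.
- exact: indep_processes_pair.
- exact: levy_sqint.
- exact: levy_sqint.
rewrite (levy_mean P L1)// mulr0 mul0r addr0.
rewrite (levy_sqr P L1)// (levy_sqr P L2)// eq_sqr ger0_norm ?subr_ge0//.
ring.
Qed.

End two_sided_levy.

(** * Isometry for step integrals, in abstract form *)

Section step_isometry.
Context {d : measure_display} {S : measurableType d} {R : realType}.
Variables (mu : {measure set S -> \bar R}) (F : R -> S -> R) (c : R).
Hypothesis sqF : forall u v, sqint mu (fun x => F u x - F v x).
Hypothesis F_sqr : forall u v, \int[mu]_x (F u x - F v x) ^+ 2 = `|u - v| * c.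

Lemma step_int_cons p sq (x : S) :
  step_int F (p :: sq) x =
  p.1.1 * (F p.2 x - F p.1.2 x) + step_int F sq x.
Proof. by rewrite /step_int big_cons. Qed.

Lemma step_int_sqint sq : sqint mu (step_int F sq).
Proof.
elim: sq => [|p sq IH].
  rewrite (_ : step_int _ _ = cst 0); first exact: sqint0.
  by apply/funext => x; rewrite /step_int big_nil.
rewrite (_ : step_int _ _ =
    (fun x => p.1.1 * (F p.2 x - F p.1.2 x) + step_int F sq x)).
  by apply: sqintD => //; exact: sqintZ.
by apply/funext => x; exact: step_int_cons.
Qed.

Lemma Rintegral_step_int_mul sq (g : S -> R) : sqint mu g ->
  \int[mu]_x (step_int F sq x * g x) =
  \sum_(p <- sq) p.1.1 * \int[mu]_x ((F p.2 x - F p.1.2 x) * g x).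
Proof.
move=> hg; elim: sq => [|p sq IH].
  rewrite big_nil; under eq_Rintegral do rewrite /step_int big_nil mul0r.
  by rewrite /Rintegral/= integral0.
rewrite big_cons -IH.
have i1 := sqint_integrable_mul mu _ _ (sqF p.2 p.1.2) hg.
have i2 := sqint_integrable_mul mu _ _ (sqintZ mu p.1.1 _ (sqF p.2 p.1.2)) hg.
have i3 := sqint_integrable_mul mu _ _ (step_int_sqint sq) hg.
rewrite -RintegralZl//.
under [in RHS]eq_Rintegral do rewrite mulrA.
rewrite -RintegralD//.
by apply: eq_Rintegral => x _; rewrite step_int_cons mulrDl.
Qed.

(** For [u <= v] and [u' <= v'] this is the length of the intersection of []u, v]] and []u',
    v']]. *)
Definition overlap (u v u' v' : R) : R :=
  (`|v - u'| + `|u - v'| - `|v - v'| - `|u - u'|) / 2.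

(* Polarization: (a - b)(c - d) =
   ((a - d)^2 + (b - c)^2 - (a - c)^2 - (b - d)^2) / 2. *)
Lemma Rintegral_increment_mul u v u' v' :
  \int[mu]_x ((F v x - F u x) * (F v' x - F u' x)) = overlap u v u' v' * c.
Proof.
have isq a b := sqint_integrable_sqr mu _ (sqF a b).
have i1 : mu.-integrable setT
    (EFin \o (fun x => (F v x - F u' x) ^+ 2 + (F u x - F v' x) ^+ 2)).
  exact: (integrableD measurableT (isq v u') (isq u v')).
have i2 : mu.-integrable setT
    (EFin \o (fun x => (F v x - F v' x) ^+ 2 + (F u x - F u' x) ^+ 2)).
  exact: (integrableD measurableT (isq v v') (isq u u')).
have i3 : mu.-integrable setT (EFin \o (fun x =>
    ((F v x - F u' x) ^+ 2 + (F u x - F v' x) ^+ 2)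
     - ((F v x - F v' x) ^+ 2 + (F u x - F u' x) ^+ 2))).
  exact: (integrableB measurableT i1 i2).
transitivity (\int[mu]_x (2^-1 *
    (((F v x - F u' x) ^+ 2 + (F u x - F v' x) ^+ 2)
     - ((F v x - F v' x) ^+ 2 + (F u x - F u' x) ^+ 2)))).
  by apply: eq_Rintegral => x _; field.
rewrite RintegralZl// RintegralB// !RintegralD// !F_sqr.
by rewrite /overlap; field.
Qed.

(** The right-hand side depends on [F] and [mu] only through [c], so step integrals of one list
    against two such families have proportional second moments. *)
Lemma step_int_isometry sq :
  \int[mu]_x (step_int F sq x) ^+ 2 =
  (\sum_(p <- sq) p.1.1 *
    \sum_(q <- sq) q.1.1 * overlap q.1.2 q.2 p.1.2 p.2) * c.
Proof.
under eq_Rintegral do rewrite expr2.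
rewrite Rintegral_step_int_mul; last exact: step_int_sqint.
rewrite mulr_suml; apply: eq_bigr => p _; rewrite -mulrA; congr (_ * _).
under eq_Rintegral do rewrite mulrC.
rewrite Rintegral_step_int_mul; last exact: sqF.
rewrite mulr_suml; apply: eq_bigr => q _; rewrite -mulrA; congr (_ * _).
exact: Rintegral_increment_mul.
Qed.

End step_isometry.

(** * Step functions as step integrals under Lebesgue measure *)

Section step_functions.
Context {R : realType}.
Local Notation leb := (@lebesgue_measure R).

(** Seen as a process with time [v]: its increments are the indicators of []u, v]], so it is a
    deterministic counterpart of the Lévy process with [c = 1]. *)
Definition below (v x : R) : R := (x <= v)%R%:R.

Lemma below_sqrE u v : u <= v ->
  (fun x : R => (below v x - below u x) ^+ 2) = \1_`]u, v].
Proof.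
move=> uv; apply/funext => x; rewrite /below indicE mem_setE in_itv/=.
have [xv|xv] := leP x v; have [xu|xu] := leP x u;
  rewrite ?subrr ?subr0 ?expr0n ?expr1n//=.
by move: (le_lt_trans xu (le_lt_trans uv xv)); rewrite ltxx.
Qed.

Lemma below_measurable v : measurable_fun setT (below v).
Proof.
rewrite (_ : below v = \1_`]-oo, v]); first exact: measurable_indic.
by apply/funext => x; rewrite /below indicE mem_setE in_itv.
Qed.

Lemma integral_below_sqr u v :
  (\int[leb]_x ((below u x - below v x) ^+ 2)%:E)%E = `|u - v|%:E.
Proof.
wlog vu : u v / v <= u.
  move=> h; have [vu|/ltW uv] := leP v u; first exact: h.
  rewrite distrC -h//; apply: eq_integral => w _.
  by congr EFin; ring.
transitivity (\int[leb]_x (\1_`]v, u] x)%:E)%E.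
  by apply: eq_integral => x _; rewrite -below_sqrE.
rewrite integral_indic//= setIT lebesgue_measure_itv/= lte_fin.
case: ltgtP vu => // [vu _|->]; last by rewrite subrr normr0.
by rewrite gtr0_norm ?subr_gt0// EFinB.
Qed.

Lemma sqint_below u v : sqint leb (fun x => below u x - below v x).
Proof.
split; first by apply: measurable_funB; exact: below_measurable.
by rewrite integral_below_sqr ltry.
Qed.

Lemma Rintegral_below_sqr u v :
  \int[leb]_x (below u x - below v x) ^+ 2 = `|u - v| * 1.
Proof. by rewrite mulr1 /Rintegral/= integral_below_sqr. Qed.

(** The ordering of endpoints matters: for [v < u] the indicator of []u, v]] is 0, while
    [below v - below u] is -1 on []v, u]]. *)
Lemma step_fun_below (sq : seq (R * R * R)) :
  all (fun p => p.1.2 <= p.2) sq -> step_fun sq = step_int below sq.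
Proof.
move=> /allP h; apply/funext => x; rewrite /step_fun /step_int.
apply: eq_big_seq => p /h pq; congr (_ * _); rewrite /below.
have [xv|xv] := leP x p.2; have [xu|xu] := leP x p.1.2;
  rewrite ?subrr ?subr0//=.
by move: (le_lt_trans xu (le_lt_trans pq xv)); rewrite ltxx.
Qed.

End step_functions.

(** * Powers of the positive part and dyadic shells *)

Section kernel_increment.
Context {R : realType}.
Local Notation leb := (@lebesgue_measure R).

Definition ppow (a y : R) : R := powR (Num.max y 0) a.

Lemma ppow_measurable a : measurable_fun setT (ppow a).
Proof.
have m : measurable_fun setT (fun y : R => Num.max y 0).
  by apply: (@measurable_maxr _ _ _ setT id (cst 0)).
exact: (measurableT_comp (measurable_powR a) m).
Qed.

Lemma ppow_ge0 a y : 0 <= ppow a y. Proof. exact: powR_ge0. Qed.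

(** The exponent 0 is excluded because [powR 0 0] is 1. *)
Lemma ppow_npos a y : a != 0 -> y <= 0 -> ppow a y = 0.
Proof. by move=> a0 y0; rewrite /ppow max_r// powR0. Qed.

Lemma ppow_pos a y : 0 <= y -> ppow a y = powR y a.
Proof. by move=> y0; rewrite /ppow max_l. Qed.

Lemma ppow_le a y z : 0 <= a -> y <= z -> ppow a y <= ppow a z.
Proof.
move=> a0 yz; apply: ge0_ler_powR => //.
- by rewrite nnegrE le_max lexx orbT.
- by rewrite nnegrE le_max lexx orbT.
- by rewrite ge_max !le_max yz lexx orbT.
Qed.

(* [(y + h)^a = y^a (1 + h/y)^a <= y^a (1 + h/y)] *)
Lemma powR_increment_le (a z y h : R) : 0 < a < 1 -> 0 < h -> 0 < z -> z <= y ->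
  powR (y + h) a - powR y a <= h * powR z (a - 1).
Proof.
move=> /andP[a0 a1] h0 z0 zy; have y0 := lt_le_trans z0 zy.
have -> : y + h = y * (1 + h / y) by field; rewrite gt_eqF.
have hy : 0 <= h / y by rewrite divr_ge0// ltW.
rewrite powRM ?(ltW y0) ?addr_ge0//.
have : powR (1 + h / y) a <= 1 + h / y.
  by apply: ler1_powR; [rewrite lerDl|exact: ltW].
move=> /(ler_wpM2l (powR_ge0 y a)) le1.
apply: (@le_trans _ _ (h * powR y (a - 1))).
  apply: (@le_trans _ _ (powR y a * (h / y))); first by lra.
  rewrite -(mulr_powRB1 (ltW y0) a0).
  rewrite le_eqVlt; apply/orP; left; apply/eqP; field.
  by rewrite gt_eqF.
apply: ler_wpM2l; first exact: ltW.
rewrite -(opprB 1 a) !powRN lef_pV2 ?posrE ?powR_gt0//.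
by apply: ge0_ler_powR; rewrite ?nnegrE ?subr_ge0 ?(ltW a1) ?(ltW z0) ?(ltW y0).
Qed.

Lemma dyadic_shell (y : R) : 1 <= y -> exists k, 2 ^+ k <= y < 2 ^+ k.+1.
Proof.
move=> y1; have y0 : 0 <= y by exact: le_trans y1.
have /andP[n1 n2] := truncn_itv y0; set n := Num.truncn y in n1 n2.
have n0 : (0 < n)%N by rewrite truncn_gt0.
exists (trunc_log 2 n); have /andP[k1 k2] := trunc_log_bounds (isT : (1 < 2)%N) n0.
rewrite -!natrX; apply/andP; split.
  by apply: le_trans n1; rewrite ler_nat.
by apply: (lt_le_trans n2); rewrite ler_nat.
Qed.

(** Shell [k] has length [2^k h], so its integral is [h (h^a)^2] times the [k]-th power of
    [2 * (2^(a-1))^2 = 2^(2a-1)]. This ratio is below 1 because [a < 1/2], that is [H < 1]. *)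
Lemma kernel_shell_sum (a s h : R) : 0 < a < 2^-1 -> 0 < h ->
  (\big[+%E/0%R]_(0 <= k <oo) \int[leb]_x
     ((h * powR (2 ^+ k * h) (a - 1)) ^+ 2
        * \1_(`]s - 2 ^+ k.+1 * h, s - 2 ^+ k * h]) x)%:E
   <= (h * powR h a ^+ 2 / (1 - 2 * powR 2 (a - 1) ^+ 2))%:E)%E.
Proof.
move=> /andP[a0 a1] h0.
have r_itv : 0 < 2 * powR 2 (a - 1) ^+ 2 < 1.
  rewrite mulr_gt0 ?exprn_gt0 ?powR_gt0//=.
  rewrite -powR_mulrn ?powR_ge0// -powRrM -{1}(powRr1 (ler0n R 2)) -powRD; last first.
    by rewrite pnatr_eq0 implybT.
  rewrite -[X in _ < X](powRr0 2) /powR !pnatr_eq0/= ltr_expR ltr_pM2r.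
    lra.
  by rewrite ln_gt0// ltr1n.
apply: nneseries_geometric_le => //.
- by rewrite mulr_ge0 ?sqr_ge0// ltW.
- move=> k; apply: integral_ge0 => x _; rewrite lee_fin mulr_ge0 ?sqr_ge0//.
move=> k; set c := _ ^+ 2.
have two0 : 0 < 2 ^+ k :> R by rewrite exprn_gt0.
under eq_integral do rewrite EFinM.
rewrite ge0_integralZl//; last 2 first.
- by apply/measurable_EFinP; exact: measurable_indic.
- by rewrite lee_fin sqr_ge0.
rewrite integral_indic//= setIT lebesgue_measure_itv/= lte_fin.
rewrite ltrD2l ltrN2 ltr_pM2r// exprS ltr_pMl// ltr1n.
rewrite -EFinB -EFinM lee_fin /c.
have -> : powR (2 ^+ k * h) (a - 1) = powR 2 (a - 1) ^+ k * powR h (a - 1).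
  rewrite powRM ?(ltW two0) ?(ltW h0)//; congr (_ * _).
  by rewrite -powR_mulrn// powRAC powR_mulrn// powR_ge0.
rewrite -(mulr_powRB1 (ltW h0) a0).
have -> : (2 * powR 2 (a - 1) ^+ 2) ^+ k = 2 ^+ k * (powR 2 (a - 1) ^+ k) ^+ 2.
  by rewrite exprMn -!exprM mulnC.
by rewrite le_eqVlt; apply/orP; left; apply/eqP; ring.
Qed.

End kernel_increment.

(** * The L^2 norm of kernel increments *)

Section kernel_L2_increment.
Context {R : realType}.
Local Notation leb := (@lebesgue_measure R).

(** Square of the bound of [powR_increment_le] with [z = 2^k h], the least value of [s - x] on the
    shell. *)
Definition shell_term (a s h : R) (k : nat) (x : R) : \bar R :=
  ((h * powR (2 ^+ k * h) (a - 1)) ^+ 2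
    * \1_(`]s - 2 ^+ k.+1 * h, s - 2 ^+ k * h]) x)%:E.

Lemma shell_term_ge0 a s h k x : (0 <= shell_term a s h k x)%E.
Proof. by rewrite lee_fin mulr_ge0 ?sqr_ge0. Qed.

Lemma shell_term_measurable a s h k : measurable_fun setT (shell_term a s h k).
Proof.
by apply/measurable_EFinP; apply: measurable_funM.
Qed.

(** Right of [s + h] both powers vanish. On [[s - h, s + h]] the difference is at most
    [(2h)^a <= 2 h^a]. Further left, [(s - x) / h >= 1] puts [x] in one dyadic shell. *)
Lemma kernel_increment_pointwise (a s h x : R) : 0 < a < 2^-1 -> 0 < h ->
  (((ppow a (s + h - x) - ppow a (s - x)) ^+ 2)%:E <=
   ((2 * powR h a) ^+ 2 * \1_`[(s - h)%R, (s + h)%R] x)%:E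
   + \big[+%E/0%R]_(0 <= k <oo) shell_term a s h k x)%E.
Proof.
move=> /andP[a0 a1] h0.
have sum0 : (0 <= \big[+%E/0%R]_(0 <= k <oo) shell_term a s h k x)%E.
  by apply: nneseries_ge0 => k _ _; exact: shell_term_ge0.
have aN0 : a != 0 by rewrite gt_eqF.
have [xt|xt] := ltP (s + h) x.
  rewrite !ppow_npos//; [|lra|lra].
  by rewrite subrr expr0n/= adde_ge0// lee_fin mulr_ge0 ?sqr_ge0.
have le12 : ppow a (s - x) <= ppow a (s + h - x) by apply: ppow_le; lra.
have p0 := ppow_ge0 a (s - x).
have [xs|xs] := leP (s - h) x.
  rewrite indicE mem_setE in_itv/= xs xt mulr1.
  apply: (@le_trans _ _ ((2 * powR h a) ^+ 2)%:E); last by rewrite leeDl.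
  rewrite lee_fin ler_sqr ?nnegrE ?subr_ge0 ?mulr_ge0 ?powR_ge0//.
  apply: (@le_trans _ _ (ppow a (2 * h))).
    have : ppow a (s + h - x) <= ppow a (2 * h) by apply: ppow_le; lra.
    lra.
  rewrite ppow_pos; last by lra.
  rewrite powRM ?(ltW h0)// ler_wpM2r ?powR_ge0//.
  by apply: ler1_powR; [rewrite ler1n|lra].
have y1 : 1 <= (s - x) / h by rewrite ler_pdivlMr// mul1r; lra.
have [k] := dyadic_shell _ y1.
rewrite ler_pdivlMr// ltr_pdivrMr// => /andP[k1 k2].
apply: (@le_trans _ _ (shell_term a s h k x)); last first.
  rewrite -[leLHS]add0e; apply: leeD.
    by rewrite lee_fin mulr_ge0 ?sqr_ge0.
  apply: le_trans (nneseries_lim_ge k.+1 _); last first.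
    by move=> n _ _; exact: shell_term_ge0.
  rewrite big_nat_recr//= leeDr//.
  by apply: sume_ge0 => i _; exact: shell_term_ge0.
rewrite /shell_term indicE mem_setE in_itv/=.
have -> : (s - 2 ^+ k.+1 * h < x <= s - 2 ^+ k * h)%R.
  by apply/andP; split; lra.
have z0 : 0 < 2 ^+ k * h by rewrite mulr_gt0// exprn_gt0.
rewrite mulr1 lee_fin ler_sqr ?nnegrE ?subr_ge0//; last first.
  by rewrite mulr_ge0 ?powR_ge0// ltW.
rewrite !ppow_pos; [|lra|lra].
rewrite (_ : s + h - x = (s - x) + h); last by ring.
by apply: powR_increment_le => //; lra.
Qed.

(** The 8 is the interval length [2h] times [(2 h^a)^2], in units of [h (h^a)^2]; the inverse is the
    sum of the geometric series over the shells. *)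
Definition kernel_const (a : R) : R := 8 + (1 - 2 * powR 2 (a - 1) ^+ 2)^-1.

Lemma kernel_increment_le (a s h : R) : 0 < a < 2^-1 -> 0 < h ->
  (\int[leb]_x ((ppow a (s + h - x) - ppow a (s - x)) ^+ 2)%:E
   <= (kernel_const a * (h * powR h a ^+ 2))%:E)%E.
Proof.
move=> a_itv h0.
have mI : measurable_fun setT
    (fun x : R => ((2 * powR h a) ^+ 2 * \1_`[s - h, s + h] x)%:E).
  by apply/measurable_EFinP; apply: measurable_funM.
have mS : measurable_fun setT
    (fun x : R => \big[+%E/0%R]_(0 <= k <oo) shell_term a s h k x)%E.
  apply: ge0_emeasurable_sum => [k x _ _|k _]; first exact: shell_term_ge0.
  exact: shell_term_measurable.
apply: (@le_trans _ _ (\int[leb]_x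
   (((2 * powR h a) ^+ 2 * \1_`[(s - h)%R, (s + h)%R] x)%:E
   + \big[+%E/0%R]_(0 <= k <oo) shell_term a s h k x))%E).
  apply: ge0_le_integral_nonmeasurable => x; first by rewrite lee_fin sqr_ge0.
  exact: kernel_increment_pointwise.
rewrite ge0_integralD//; last 2 first.
- by move=> x _; rewrite lee_fin mulr_ge0 ?sqr_ge0.
- by move=> x _; apply: nneseries_ge0 => k _ _; exact: shell_term_ge0.
rewrite integral_nneseries//; last 2 first.
- by move=> k; exact: shell_term_measurable.
- by move=> k x _; exact: shell_term_ge0.
have -> : kernel_const a * (h * powR h a ^+ 2) = 8 * (h * powR h a ^+ 2)
    + h * powR h a ^+ 2 / (1 - 2 * powR 2 (a - 1) ^+ 2).
  by rewrite /kernel_const [LHS]mulrDl [_^-1 * _]mulrC.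
rewrite [leRHS]EFinD; apply: leeD; last exact: kernel_shell_sum.
under eq_integral do rewrite EFinM.
rewrite ge0_integralZl//; last 2 first.
- by apply/measurable_EFinP; exact: measurable_indic.
- by rewrite lee_fin sqr_ge0.
rewrite integral_indic//= setIT lebesgue_measure_itv/= lte_fin.
rewrite ifT; last by lra.
by rewrite -EFinB -EFinM lee_fin le_eqVlt; apply/orP; left; apply/eqP; ring.
Qed.

Lemma f_HE (H t x : R) :
  f_H H t x = C_H H * (ppow (H - 2^-1) (t - x) - ppow (H - 2^-1) (- x)).
Proof. by []. Qed.

Lemma f_H_measurable (H t : R) : measurable_fun setT (f_H H t).
Proof.
apply: measurable_funM => //; apply: measurable_funB.
  apply: (measurableT_comp (ppow_measurable (H - 2^-1))).
  exact: measurable_funB.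
apply: (measurableT_comp (ppow_measurable (H - 2^-1))).
exact: oppr_measurable.
Qed.

(** The term in [- x] cancels in the difference, so the signs of [s] and [t] are irrelevant; the
    exponent is [1 + 2 (H - 1/2) = 2 H]. *)
Lemma f_H_increment_le (H s t : R) : 2^-1 < H < 1 -> s < t ->
  (\int[leb]_x ((f_H H t x - f_H H s x) ^+ 2)%:E
   <= (C_H H ^+ 2 * kernel_const (H - 2^-1) * powR (t - s) (2 * H))%:E)%E.
Proof.
move=> /andP[H0 H1] st; set a := H - 2^-1; set h := t - s.
have h0 : 0 < h by rewrite subr_gt0.
have a_itv : 0 < a < 2^-1 by rewrite /a; apply/andP; split; lra.
have -> : powR h (2 * H) = h * powR h a ^+ 2.
  rewrite -powR_mulrn ?powR_ge0// -powRrM -{2}(powRr1 (ltW h0)) -powRD; last first.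
    by rewrite (gt_eqF h0) implybT.
  by congr (powR _ _); rewrite /a; field.
have -> : (\int[leb]_x ((f_H H t x - f_H H s x) ^+ 2)%:E =
    \int[leb]_x ((C_H H ^+ 2)%:E
      * ((ppow a (s + h - x) - ppow a (s - x)) ^+ 2)%:E))%E.
  apply: eq_integral => x _; rewrite -EFinM !f_HE -/a; congr EFin.
  by rewrite (_ : s + h - x = t - x); [ring|rewrite /h; ring].
rewrite ge0_integralZl//; last 3 first.
- apply: measurable_sqr; apply: measurable_funB.
    by apply: (measurableT_comp (ppow_measurable a)); exact: measurable_funB.
  by apply: (measurableT_comp (ppow_measurable a)); exact: measurable_funB.
- by move=> x _; rewrite lee_fin sqr_ge0.
- by rewrite lee_fin sqr_ge0.
rewrite -mulrA [leRHS]EFinM; apply: lee_wpmul2l; first by rewrite lee_fin sqr_ge0.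
exact: kernel_increment_le.
Qed.

End kernel_L2_increment.

(** * Three-term splitting and differences of step functions *)

Section sums_of_squares.
Context {d : measure_display} {S : measurableType d} {R : realType}.
Variable mu : {measure set S -> \bar R}.

Lemma integral_sqr_add3_le (f g h : S -> R) (a b c : R) :
  measurable_fun setT f -> measurable_fun setT g -> measurable_fun setT h ->
  (\int[mu]_x (f x ^+ 2)%:E <= a%:E)%E ->
  (\int[mu]_x (g x ^+ 2)%:E <= b%:E)%E ->
  (\int[mu]_x (h x ^+ 2)%:E <= c%:E)%E ->
  (\int[mu]_x ((f x + g x + h x) ^+ 2)%:E <= (3 * (a + b + c))%:E)%E.
Proof.
move=> mf mg mh fa gb hc.
have sq0 (k : S -> R) x : (0 <= (k x ^+ 2)%:E)%E by rewrite lee_fin sqr_ge0.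
apply: (@le_trans _ _ (\int[mu]_x
    (3%:E * ((f x ^+ 2)%:E + (g x ^+ 2)%:E + (h x ^+ 2)%:E)))%E).
  apply: ge0_le_integral_nonmeasurable => x; first by rewrite lee_fin sqr_ge0.
  rewrite -!EFinD -EFinM lee_fin.
  have := sqr_ge0 (f x - g x); have := sqr_ge0 (g x - h x).
  have := sqr_ge0 (f x - h x); nra.
rewrite ge0_integralZl//; last 2 first.
- by do 2?apply: emeasurable_funD; exact: measurable_sqr.
- by move=> x _; rewrite !adde_ge0.
rewrite ge0_integralD//; last 3 first.
- by move=> x _; rewrite adde_ge0.
- by apply: emeasurable_funD; exact: measurable_sqr.
- exact: measurable_sqr.
rewrite ge0_integralD//; [|exact: measurable_sqr|exact: measurable_sqr].
rewrite [leRHS]EFinM; apply: lee_wpmul2l => //.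
by rewrite !EFinD; apply: leeD => //; exact: leeD.
Qed.

End sums_of_squares.

Section step_differences.
Context {R : realType}.

(** The coefficient changes sign rather than the endpoints trading places, so that intervals stay
    ordered. *)
Definition neg_step (sq : seq (R * R * R)) : seq (R * R * R) :=
  [seq (- p.1.1, p.1.2, p.2) | p <- sq].

Lemma step_int_diff {T : Type} (L : R -> T -> R) sq1 sq2 w :
  step_int L (sq1 ++ neg_step sq2) w = step_int L sq1 w - step_int L sq2 w.
Proof.
rewrite /step_int big_cat big_map/=; congr (_ + _).
by rewrite -sumrN; apply: eq_bigr => p _; rewrite mulNr.
Qed.

Lemma step_fun_diff (sq1 sq2 : seq (R * R * R)) x :
  step_fun (sq1 ++ neg_step sq2) x = step_fun sq1 x - step_fun sq2 x.
Proof.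
rewrite /step_fun big_cat big_map/=; congr (_ + _).
by rewrite -sumrN; apply: eq_bigr => p _; rewrite mulNr.
Qed.

Lemma all_neg_step (sq1 sq2 : seq (R * R * R)) :
  all (fun p => p.1.2 <= p.2) sq1 -> all (fun p => p.1.2 <= p.2) sq2 ->
  all (fun p => p.1.2 <= p.2) (sq1 ++ neg_step sq2).
Proof. by move=> h1 h2; rewrite all_cat h1 all_map. Qed.

Lemma step_fun_measurable (sq : seq (R * R * R)) :
  all (fun p => p.1.2 <= p.2) sq -> measurable_fun setT (step_fun sq).
Proof.
move=> h; rewrite step_fun_below//.
by have [] := step_int_sqint (@lebesgue_measure R) (@below R) sqint_below sq.
Qed.

Lemma cvge0_near_le (u : nat -> \bar R) (e : R) : 0 < e ->
  u n @[n --> \oo] --> 0%E -> \forall n \near \oo, (u n <= e%:E)%E.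
Proof.
move=> e0 u0.
have h : nbhs (0%E : \bar R) [set x | (x < e%:E)%E].
  by apply: open_nbhs_nbhs; split; [exact: open_ereal_lt_ereal|rewrite /= lte_fin].
have : \forall n \near \oo, (u n < e%:E)%E := u0 _ h.
by apply: filterS => n /ltW.
Qed.

End step_differences.

(** * Second moments of the increments of [X] *)

Section MvN_increments.
Context {d : measure_display} {T : measurableType d} {R : realType}.
Variables (P : probability T R) (L1 L2 X : R -> T -> R) (H : R).
Hypotheses (H_itv : 2^-1 < H < 1).
Hypotheses (levyL1 : levy_process P L1) (levyL2 : levy_process P L2).
Hypothesis indepL : indep_processes P L1 L2.
Hypotheses (sqL1 : sqint P (L1 1)) (sqL2 : sqint P (L2 1)).
Hypotheses (meanL1 : \int[P]_w L1 1 w = 0) (meanL2 : \int[P]_w L2 1 w = 0).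
Hypothesis eq_sqr : \int[P]_w L2 1 w ^+ 2 = \int[P]_w L1 1 w ^+ 2.
Hypothesis XL : fLpMvN P H (two_sided L1 L2) X.

Local Notation Lv := (two_sided_version L1 L2).
Local Notation leb := (@lebesgue_measure R).
Local Notation s2 := (\int[P]_w L1 1 w ^+ 2).

Lemma Lv_sqintB u v : sqint P (fun w => Lv u w - Lv v w).
Proof.
by apply: sqintB; exact: (two_sided_version_sqint P L1 L2).
Qed.

Lemma step_int_two_sided_ae (sq : seq (R * R * R)) :
  {ae P, forall w, step_int (two_sided L1 L2) sq w = step_int Lv sq w}.
Proof.
elim: sq => [|p sq IH].
  by apply: aeW => w; rewrite /step_int !big_nil.
have h := two_sided_ae P L1 L2 levyL2 sqL2 meanL2.
move: (h p.2) (h p.1.2) IH; apply: filterS3 => w h1 h2 h3.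
by rewrite !step_int_cons h1 h2 h3.
Qed.

Lemma step_int_Lv_isometry sq : all (fun p => p.1.2 <= p.2) sq ->
  (\int[P]_w (step_int Lv sq w ^+ 2)%:E =
   s2%:E * \int[leb]_x (step_fun sq x ^+ 2)%:E)%E.
Proof.
move=> hsq; rewrite step_fun_below//.
have q1 : sqint P (step_int Lv sq) by apply: step_int_sqint; exact: Lv_sqintB.
have q2 : sqint leb (step_int below sq).
  by apply: step_int_sqint; exact: sqint_below.
rewrite (sqint_integralE P _ q1) (sqint_integralE leb _ q2) -EFinM.
rewrite (step_int_isometry P Lv s2 Lv_sqintB); last first.
  exact: (two_sided_increment_sqr P L1 L2).
rewrite (step_int_isometry leb below 1 sqint_below Rintegral_below_sqr).
by rewrite mulr1 mulrC.
Qed.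

Lemma MvN_measurable t : measurable_fun setT (X t).
Proof. by have [] := XL t. Qed.

Lemma step_int_Lv_measurable sq : measurable_fun setT (step_int Lv sq).
Proof. by have [] := step_int_sqint P Lv Lv_sqintB sq. Qed.

Lemma MvN_approx t (e : R) : 0 < e -> exists sq,
  [/\ all (fun p => p.1.2 <= p.2) sq,
      (\int[leb]_x ((step_fun sq x - f_H H t x) ^+ 2)%:E <= e%:E)%E &
      (\int[P]_w ((step_int Lv sq w - X t w) ^+ 2)%:E <= e%:E)%E].
Proof.
move=> e0; have [_ [sq [h1 h2 h3]]] := XL t.
have [n [n2 n3]] : exists n,
    ((\int[leb]_x ((step_fun (sq n) x - f_H H t x) ^+ 2)%:E <= e%:E) /\
    (\int[P]_w ((step_int (two_sided L1 L2) (sq n) w - X t w) ^+ 2)%:E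
       <= e%:E))%E.
  apply: (@filter_ex _ \oo).
  by move: (cvge0_near_le _ _ e0 h2) (cvge0_near_le _ _ e0 h3); apply: filterS2.
exists (sq n); split => //; apply: le_trans n3.
(* [Lv] is on the smaller, measurable side; nothing is asked of [two_sided]. *)
apply: ae_ge0_le_integral_nonmeasurable.
- apply: measurable_sqr; apply: measurable_funB; last exact: MvN_measurable.
  exact: step_int_Lv_measurable.
- by move=> w; rewrite lee_fin sqr_ge0.
- by move=> w; rewrite lee_fin sqr_ge0.
- by have := step_int_two_sided_ae (sq n); apply: filterS => w ->.
Qed.

(** Both [f_H] and [X] are reached through the same step functions, so three-term splitting is used
    once on the line and once on [T]: the factor 9 is [3 * 3]. *)
Lemma MvN_increment_le s t : s < t ->
  (\int[P]_w ((X t w - X s w) ^+ 2)%:E <=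
   (9 * s2 * (C_H H ^+ 2 * kernel_const (H - 2^-1)) * powR (t - s) (2 * H))%:E)%E.
Proof.
move=> st.
pose D := C_H H ^+ 2 * kernel_const (H - 2^-1) * powR (t - s) (2 * H).
have s20 : 0 <= s2 by apply: Rintegral_ge0 => w _; exact: sqr_ge0.
have hD := f_H_increment_le H s t H_itv st.
apply/lee_addgt0Pr => eps eps0.
(* The two splittings give [3 (e + s2 * 3 (e + D + e) + e) = 9 s2 D + (6 + 18 s2) e]. *)
pose e := eps / (6 + 18 * s2).
have den0 : 0 < 6 + 18 * s2 by lra.
have e0 : 0 < e by rewrite divr_gt0.
have [sq1 [a1 b1 c1]] := MvN_approx t e e0.
have [sq2 [a2 b2 c2]] := MvN_approx s e e0.
have mf u : measurable_fun setT (f_H H u) := f_H_measurable H u.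
have m1 := step_fun_measurable _ a1; have m2 := step_fun_measurable _ a2.
have mX := MvN_measurable; have mI := step_int_Lv_measurable.
have flip (d' : measure_display) (S : measurableType d')
    (mu : {measure set S -> \bar R}) (f g : S -> R) :
    (\int[mu]_x ((f x - g x) ^+ 2)%:E = \int[mu]_x ((g x - f x) ^+ 2)%:E)%E.
  by apply: eq_integral => x _; congr EFin; ring.
have bnd1 : (\int[leb]_x ((step_fun sq1 x - step_fun sq2 x) ^+ 2)%:E
    <= (3 * (e + D + e))%:E)%E.
  rewrite flip in b2.
  have := integral_sqr_add3_le leb _ _ _ _ _ _
    (measurable_funB m1 (mf t)) (measurable_funB (mf t) (mf s))
    (measurable_funB (mf s) m2) b1 hD b2.
  by apply: le_trans; rewrite le_eqVlt; apply/orP; left; apply/eqP;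
     apply: eq_integral => x _ /=; congr EFin; ring.
have bnd2 : (\int[P]_w ((step_int Lv sq1 w - step_int Lv sq2 w) ^+ 2)%:E
    <= (s2 * (3 * (e + D + e)))%:E)%E.
  have -> : (\int[P]_w ((step_int Lv sq1 w - step_int Lv sq2 w) ^+ 2)%:E =
      s2%:E * \int[leb]_x ((step_fun sq1 x - step_fun sq2 x) ^+ 2)%:E)%E.
    under eq_integral do rewrite -step_int_diff.
    under [in RHS]eq_integral do rewrite -step_fun_diff.
    by rewrite step_int_Lv_isometry// all_neg_step.
  by rewrite [leRHS]EFinM; apply: lee_wpmul2l => //; rewrite lee_fin.
rewrite flip in c1.
have := integral_sqr_add3_le P _ _ _ _ _ _
  (measurable_funB (mX t) (mI sq1)) (measurable_funB (mI sq1) (mI sq2))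
  (measurable_funB (mI sq2) (mX s)) c1 bnd2 c2.
have -> : (3 * (e + s2 * (3 * (e + D + e)) + e))%:E =
    (9 * s2 * (C_H H ^+ 2 * kernel_const (H - 2^-1)) * powR (t - s) (2 * H))%:E
      + eps%:E :> \bar R.
  rewrite -EFinD; congr EFin.
  have -> : eps = e * (6 + 18 * s2) by rewrite /e divfK// gt_eqF.
  by rewrite /D; ring.
by apply: le_trans; rewrite le_eqVlt; apply/orP; left; apply/eqP;
   apply: eq_integral => x _ /=; congr EFin; ring.
Qed.

End MvN_increments.
Theorem mainTheorem7 (d : measure_display) (T : measurableType d) (R : realType)
  (P : probability T R) (H : R) (L1 L2 X : R -> T -> R) :
  2^-1 < H < 1 ->
  levy_process P L1 -> levy_process P L2 ->
  indep_processes P L1 L2 -> same_law P L1 L2 ->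
  no_gaussian_component P (L1 1) ->
  P.-integrable setT (EFin \o (fun w => L1 1 w ^+ 2)) ->
  ('E_P[L1 1%R] = 0)%E ->
  fLpMvN P H (two_sided L1 L2) X ->
  forall s t : R, s < t ->
    {ae P, forall w,
      (fun n : nat => \sum_(j < 2 ^ n)
          (X (s + j.+1%:R / (2 ^ n)%:R * (t - s)) w
           - X (s + j%:R / (2 ^ n)%:R * (t - s)) w) ^+ 2) @ \oo --> 0}.
Proof.
move=> H_itv levyL1 levyL2 indepL lawL _ iL1 EL1 XL s t st.
have sqL1 : sqint P (L1 1).
  by apply: integrable_sqint => //; exact: (levy_measurable P L1 levyL1).
have meanL1 : \int[P]_w L1 1 w = 0.
  by move: EL1; rewrite unlock /Rintegral => ->.
have m1 := levy_measurable P L1 levyL1 1.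
have m2 := levy_measurable P L2 levyL2 1.
have law1 : eq_law P (L1 1) (L2 1).
  move=> B mB; have := lawL 1%N (fun=> 1) (fun=> B) (fun=> mB).
  have E (L : R -> T -> R) :
      fdd_event L (fun _ : 'I_1 => 1) (fun=> B) = L 1 @^-1` B.
    by apply/seteqP; split => [w /(_ ord0)|w Bw i _]; [exact|].
  by rewrite !E.
have sqL2 := eq_law_sqint P _ _ m1 m2 law1 sqL1.
have meanL2 : \int[P]_w L2 1 w = 0 by rewrite -(eq_law_mean P _ _ m1 m2 law1).
have eq_sqr : \int[P]_w L2 1 w ^+ 2 = \int[P]_w L1 1 w ^+ 2.
  by congr fine; rewrite (eq_law_sqr P _ _ m1 m2 law1).
have incr := MvN_increment_le P L1 L2 X H H_itv levyL1 levyL2 indepL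
  sqL1 sqL2 meanL1 meanL2 eq_sqr XL.
have mX := MvN_measurable P L1 L2 X H XL.
set K := 9 * _ * _ in incr.
have H0 : 0 < H by move: H_itv => /andP[]; lra.
(* Level [n] has [2^n] increments of second moment at most [K (t - s)^(2H) 2^(-2Hn)]; the ratio
   [2^(1 - 2H)] is below 1 because [H > 1/2]. *)
apply: (@ae_cvg0_geometric _ _ _ P _ (K * powR (t - s) (2 * H))
  (2 * powR 2 (- (2 * H)))).
- move=> n; apply: measurable_sum => j.
  by apply: measurable_funX; apply: measurable_funB.
- by move=> n w; apply: sumr_ge0 => j _; exact: sqr_ge0.
- rewrite mulr_gt0 ?powR_gt0//=.
  rewrite -{1}(powRr1 (ler0n R 2)) -powRD; last by rewrite pnatr_eq0 implybT.
  rewrite -[X in _ < X](powRr0 2) /powR !pnatr_eq0/= ltr_expR ltr_pM2r.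
    by move: H_itv => /andP[]; lra.
  by rewrite ln_gt0// ltr1n.
move=> n.
have N0 : 0 < (2 ^ n)%:R :> R by rewrite ltr0n expn_gt0.
under eq_integral do rewrite -sumEFin.
rewrite ge0_integral_sum//; last 2 first.
- by move=> j; apply: measurable_sqr; exact: measurable_funB.
- by move=> j w _; rewrite lee_fin sqr_ge0.
apply: (@le_trans _ _
    (\sum_(j < 2 ^ n) (K * powR ((t - s) / (2 ^ n)%:R) (2 * H))%:E)%E).
  apply: lee_sum => j _.
  have dE : s + j.+1%:R / (2 ^ n)%:R * (t - s) - (s + j%:R / (2 ^ n)%:R * (t - s))
      = (t - s) / (2 ^ n)%:R by rewrite -natr1; field; rewrite gt_eqF.
  rewrite -dE; apply: incr.
  by rewrite -subr_gt0 dE divr_gt0// subr_gt0.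
rewrite sumEFin lee_fin sumr_const card_ord -[leLHS]mulr_natl.
have ts0 : 0 <= t - s by rewrite subr_ge0 ltW.
have -> : powR ((t - s) / (2 ^ n)%:R) (2 * H) =
    powR (t - s) (2 * H) * powR 2 (- (2 * H)) ^+ n.
  rewrite powRM// ?invr_ge0 ?ltW//; congr (_ * _).
  rewrite -(powR_inv1 (ltW N0)) -powRrM mulN1r natrX -powR_mulrn// -powRrM.
  by rewrite mulrC powRrM powR_mulrn// powR_ge0.
by rewrite exprMn natrX le_eqVlt; apply/orP; left; apply/eqP; ring.
Qed.
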